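(* Let $k$ and $\ell$ be integers such that $k \geq 3$, $2 \leq \ell \leq k-1$ and $k-\ell$ divides $k$. Then for any $\mu > 0$ there exists $n_0$ such that for any $n \geq n_0$ which is divisible by $2k$, there is a $k$-graph $H$ on $n$ vertices such that (a) $H$ is $(2^{-\binom{k}{\ell}},\mu)$-dense, (b) $\delta_j(H) \geq \left(2^{-\binom{k}{\ell}} - \mu\right)\binom{n}{k-j}$ for any $1 \leq j \leq \ell$, and (c) $H$ does not contain a Hamilton $\ell$-cycle.
   Context: A $k$-uniform hypergraph ($k$-graph) $H$ consists of a finite vertex set $V(H)$ and a set $E(H)$ of edges, each a $k$-element subset of $V(H)$. For $0<p<1$ and $\mu>0$, a $k$-graph $H$ on $n$ vertices is $(p,\mu)$-dense if for any (not necessarily disjoint) $X_1,\dots,X_k \subseteq V(H)$ we have $e(X_1,\dots,X_k) \geq p|X_1|\cdots|X_k| - \mu n^k$, where $e(X_1,\dots,X_k)$ is the number of $k$-tuples $(x_1,\dots,x_k) \in X_1\times\cdots\times X_k$ such that $\{x_1,\dots,x_k\} \in E(H)$. For a set $S\subseteq V(H)$, the degree $d_H(S)$ is the number of edges of $H$ which contain $S$ as a subset, and $\delta_j(H)$ is the minimum of $d_H(S)$ over all $j$-element subsets $S$ of $V(H)$. A $k$-graph $C$ is an $\ell$-cycle if its vertices can be cyclically ordered in such a way that each edge of $C$ consists of $k$ consecutive vertices and each edge intersects the subsequent edge in exactly $\ell$ vertices (so an $\ell$-cycle on $n$ vertices has $n/(k-\ell)$ edges). A $k$-graph $H$ on $n$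 vertices contains a Hamilton $\ell$-cycle if it contains an $n$-vertex $\ell$-cycle as a subgraph. *)

(* Defs.v *)
(* Mathematical Components. *)
From HB Require Import structures.
From mathcomp Require Import all_boot all_order all_algebra.
From mathcomp Require Import reals.

Set Implicit Arguments.
Unset Strict Implicit.
Unset Printing Implicit Defensive.

Import Order.TTheory GRing.Theory Num.Theory.
Local Open Scope ring_scope.

(* k-uniform hypergraphs with vertex set T. *)
Record kgraph (k : nat) (T : finType) := KGraph {
  edges : {set {set T}};
  edges_uniform : forall e, e \in edges -> #|e| = k
}.

(* e(X_1, ..., X_k). *)
Definition edge_tuples (k : nat) (T : finType) (H : kgraph k T)
    (X : 'I_k -> {set T}) : nat :=
  #|[set x : {ffun 'I_k -> T} |
      [forall i, x i \in X i] && ([set x i | i : 'I_k] \in edges H)]|.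

Definition dense (R : realType) (k : nat) (T : finType) (p mu : R)
    (H : kgraph k T) : Prop :=
  forall X : 'I_k -> {set T},
    p * (\prod_(i < k) #|X i|%:R) - mu * #|T|%:R ^+ k
      <= (edge_tuples H X)%:R.

Definition degree (k : nat) (T : finType) (H : kgraph k T) (S : {set T}) : nat :=
  #|[set e in edges H | S \subset e]|.

(* Since degree H S <= #|edges H| for every S, the initial value of the
   iterated minimum does not affect the result when j <= #|T|. *)
Definition min_degree (k : nat) (T : finType) (H : kgraph k T) (j : nat) : nat :=
  \big[minn/#|edges H|]_(S : {set T} | #|S| == j) degree H S.

(* The k vertices that are consecutive in the cyclic ordering s, starting at
   position p. *)
Definition segment (k : nat) (T : finType) (s : seq T) (p : nat) : {set T} :=
  [set x in take k (rot p s)].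

(* s is a cyclic ordering of all the vertices, and P lists in increasing order
   the positions at which the edges start; next P is the successor in P taken
   cyclically, so it sends an edge to the subsequent one. The number of edges,
   #|T| / (k - l), is required explicitly: without it an edgeless C, or two
   segments sharing l vertices, would satisfy the other conditions. *)
Definition is_cycle (k l : nat) (T : finType) (C : kgraph k T) : Prop :=
  exists (s : seq T) (P : seq nat),
    [/\ uniq s /\ (forall x, x \in s),
        sorted ltn P /\ (forall p, p \in P -> (p < size s)%N),
        edges C =i [seq segment k s p | p <- P],
        forall p, p \in P ->
          #|segment k s p :&: segment k s (next P p)| = l
      & (#|edges C| * (k - l))%N = #|T| ].

(* An ℓ-cycle with #|T| vertices inside H has all of T as its vertex set. *)
Definition has_hamilton_cycle (k l : nat) (T : finType) (H : kgraph k T) : Prop :=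
  exists C : kgraph k T, is_cycle l C /\ edges C \subset edges H.

(* Main.v *)
Require Import Defs.
From HB Require Import structures.
From mathcomp Require Import all_boot all_order all_algebra.
From mathcomp Require Import reals.
From mathcomp Require Import ring lra zify sequences exp.

Set Implicit Arguments.
Unset Strict Implicit.
Unset Printing Implicit Defensive.

Import Order.TTheory GRing.Theory Num.Theory.
Local Open Scope ring_scope.

(** Colour the [l]-subsets of the vertex set with two colours, uniformly at
    random, and fix a set [X] of odd size containing about half of the vertices.
    The edges are the [k]-sets [e] all of whose [l]-subsets have the colour given
    by the parity of [#|e :&: X|].  A given [k]-set is an edge with probability
    [2 ^- 'C(k, l)].

    There is no Hamilton [l]-cycle, whatever the colouring is
    ([parity_kgraph_no_hamilton_cycle]).  Consecutive edges of the cycle share an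
    [l]-set, whose colour is the parity of both edges; so all edges of the cycle
    have the same parity.  As [k - l] divides [k], the cycle contains a perfect
    matching, and this matching has [n / k] members, an even number.  Summing
    over it shows that [#|X|] is even, a contradiction.

    Density and degrees hold for almost all colourings by bounded differences.
    The count of edge tuples in given sets, and the degree of a given [l]-set,
    are both sums of indicators of the form: all indices in [F a] have the colour
    [g a].  [monochromatic_tail] bounds the lower tail of such a sum when every
    index lies in few of the sets [F a].  For tuples the failure probability is
    [expR (- c * n ^ 2)], where [2 <= l] is essential, and for degrees it is
    [expR (- c * n)]; this beats the [2 ^ (n * k)] choices of the sets, and the
    at most [n ^ l] choices of the [l]-set ([exists_good_colouring]).  The
    expected degree of an [l]-set depends on its own colour only through the
    number of its [k]-supersets of each parity, and those two numbers are nearly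
    equal because [X] is balanced ([card_parity_supersets]).  Averaging over
    [l]-sets gives the degrees of smaller sets. *)

(** * Concentration on the discrete cube *)

Lemma cosh_le_small (R : realType) (x : R) :
  `|x| <= 2^-1 -> expR x + expR (- x) <= 2 * expR (2 * x ^+ 2).
Proof.
move=> hx; have x2 : x ^+ 2 <= 4^-1.
  by rewrite -real_normK ?num_real //; have := normr_ge0 x; nra.
move: hx; rewrite ler_norml => /andP[hx1 hx2].
have h1 : expR x <= (1 - x)^-1.
  rewrite -[x in expR x]opprK expRN lef_pV2 ?posrE ?expR_gt0 //; last lra.
  exact: expR_ge1Dx.
have h2 : expR (- x) <= (1 + x)^-1.
  rewrite expRN lef_pV2 ?posrE ?expR_gt0 //; last lra.
  exact: expR_ge1Dx.
have h3 : (1 - x)^-1 + (1 + x)^-1 <= 2 * (1 + 2 * x ^+ 2).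
  have -> : (1 - x)^-1 + (1 + x)^-1 = 2 / (1 - x ^+ 2).
    by field; apply/and3P; split; lra.
  rewrite ler_pdivrMr; last lra.
  nra.
apply: (le_trans (lerD h1 h2)); apply: (le_trans h3).
by rewrite ler_pM2l // expR_ge1Dx.
Qed.

(** Doubling the argument turns c = cosh x into 2 c ^ 2 - 1, which preserves
    the shape of the bound, so the estimate near the origin spreads to the whole
    line. *)
Lemma cosh_le (R : realType) (x : R) :
  expR x + expR (- x) <= 2 * expR (2 * x ^+ 2).
Proof.
suff H : forall n (y : R), `|y| <= 2 ^+ n / 2 ->
    expR y + expR (- y) <= 2 * expR (2 * y ^+ 2).
  apply: (H (Num.bound (2 * `|x|))).
  rewrite ler_pdivlMr // mulrC; apply: ltW.
  apply: (lt_le_trans (archi_boundP _)); first by rewrite mulr_ge0.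
  by rewrite -natrX ler_nat ltnW // ltn_expl.
elim=> [|n IHn] y hy; first by apply: cosh_le_small; rewrite expr0 mul1r in hy.
have /IHn : `|y / 2| <= 2 ^+ n / 2.
  rewrite normrM [`|2^-1|]ger0_norm ?invr_ge0 //.
  by rewrite ler_pM2r ?invr_gt0 //; move: hy; rewrite exprS; lra.
have : y = y / 2 + y / 2 by field.
move: (y / 2) => z -> IH.
rewrite opprD !expRD.
have -> : 2 * (z + z) ^+ 2 = 4%:R * (2 * z ^+ 2) by ring.
rewrite expRM_natl.
have e1 : expR z * expR (- z) = 1 by rewrite -expRD subrr expR0.
have p1 := expR_gt0 z; have p2 := expR_gt0 (- z).
have p3 := expR_gt0 (2 * z ^+ 2).
move: IH e1 p1 p2 p3.
move: (expR z) (expR (- z)) (expR (2 * z ^+ 2)) => a b c IH e1 p1 p2 p3.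
have h : (a + b) ^+ 2 <= (2 * c) ^+ 2.
  by rewrite ler_pXn2r ?nnegrE //; lra.
have : 0 <= (c ^+ 2 - 1) ^+ 2 by apply: sqr_ge0.
nra.
Qed.

Definition flip (I : finType) (i : I) (f : {ffun I -> bool}) : {ffun I -> bool} :=
  [ffun j => if j == i then ~~ f j else f j].

Lemma flipK (I : finType) (i : I) : involutive (flip i).
Proof.
by move=> f; apply/ffunP=> j; rewrite !ffunE; case: eqP => // _; rewrite negbK.
Qed.

Lemma flipC (I : finType) (i j : I) (f : {ffun I -> bool}) :
  flip i (flip j f) = flip j (flip i f).
Proof.
by apply/ffunP=> t; rewrite !ffunE; case: (t == i); case: (t == j).
Qed.

Lemma sum_flip (R : realType) (I : finType) (i : I)
    (Z : {ffun I -> bool} -> R) :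
  \sum_f Z (flip i f) = \sum_f Z f.
Proof.
rewrite [RHS](reindex_inj (h := flip i)) //.
exact: inv_inj (@flipK I i).
Qed.

Definition flip_avg (R : realType) (I : finType) (i : I)
    (Z : {ffun I -> bool} -> R) (f : {ffun I -> bool}) : R :=
  (Z f + Z (flip i f)) / 2.

Lemma sum_flip_avg (R : realType) (I : finType) (i : I)
    (Z : {ffun I -> bool} -> R) :
  \sum_f flip_avg i Z f = \sum_f Z f.
Proof.
rewrite /flip_avg -mulr_suml big_split /= sum_flip.
by field.
Qed.

Lemma flip_invariant_const (T : Type) (I : finType)
    (Z : {ffun I -> bool} -> T) :
  (forall i f, Z (flip i f) = Z f) -> forall f g, Z f = Z g.
Proof.
move=> inv f g.
suff H (s : seq I) : forall f g : {ffun I -> bool},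
    (forall i, i \notin s -> f i = g i) -> Z f = Z g.
  by apply: (H (enum I)) => i; rewrite mem_enum.
elim: s => [|i s IHs] {}f {}g fg.
  by congr Z; apply/ffunP=> i; apply: fg.
have [fgi|fgi] := boolP (f i == g i).
  apply: IHs => j js; have [->|ji] := eqVneq j i; first exact/eqP.
  by apply: fg; rewrite inE negb_or ji.
rewrite -(inv i f); apply: IHs => j js; rewrite ffunE.
have [->|ji] := eqVneq j i; first by case: (f i) (g i) fgi => [] [].
by apply: fg; rewrite inE negb_or ji.
Qed.

(** Averaging over one coordinate at a time: [flip_avg i] kills the influence of
    [i] without increasing the others, preserves the mean, and costs a factor
    [expR (c i ^+ 2 / 2)] in the exponential moment because of the bound on
    cosh.  When all coordinates have been averaged, only the mean is left. *)
Lemma exp_moment_le (R : realType) (I : finType) (s : seq I) (c : I -> R)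
    (Z : {ffun I -> bool} -> R) :
  (forall i, i \notin s -> c i = 0) ->
  (forall i f, `|Z f - Z (flip i f)| <= c i) ->
  \sum_f expR (Z f) <=
    #|{ffun I -> bool}|%:R
      * expR ((\sum_f Z f) / #|{ffun I -> bool}|%:R + \sum_(i <- s) c i ^+ 2 / 2).
Proof.
elim: s c Z => [|i s IHs] c Z c0 infl.
  have cst : forall f g, Z f = Z g.
    apply: flip_invariant_const => i f; apply/esym/eqP.
    by rewrite -subr_eq0 -normr_le0 -(c0 i).
  have N0 : #|{ffun I -> bool}|%:R != 0 :> R.
    by rewrite pnatr_eq0 card_ffun card_bool expn_eq0.
  pose f0 : {ffun I -> bool} := [ffun=> true].
  rewrite (eq_bigr (fun=> expR (Z f0))); last by move=> f _; rewrite (cst f f0).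
  rewrite [X in X / _](eq_bigr (fun=> Z f0)); last by move=> f _; rewrite (cst f f0).
  rewrite !sumr_const big_nil addr0 -[Z f0 *+ _]mulr_natr mulfK //.
  by rewrite -[_ *+ _]mulr_natl.
(* The bounds that remain after [i] has been averaged out. *)
pose c' j := if j == i then 0 else c j.
have step : \sum_f expR (Z f) <=
    expR (c i ^+ 2 / 2) * \sum_f expR (flip_avg i Z f).
  rewrite -(sum_flip_avg i) mulr_sumr; apply: ler_sum => f _.
  rewrite /flip_avg.
  set a := Z f; set b := Z (flip i f).
  have ab : ((a - b) / 2) ^+ 2 * 2 <= c i ^+ 2 / 2.
    have h : (a - b) ^+ 2 <= c i ^+ 2.
      rewrite -[(a - b) ^+ 2]real_normK ?num_real //.
      by rewrite ler_pXn2r ?nnegrE //; apply: le_trans (infl i f).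
    nra.
  have -> : expR a + expR b =
      expR ((a + b) / 2) * (expR ((a - b) / 2) + expR (- ((a - b) / 2))).
    by rewrite mulrDr -!expRD; congr (expR _ + expR _); field.
  rewrite [leRHS]mulrC -mulrA ler_pM2l ?expR_gt0 // ler_pdivrMr //.
  rewrite [leRHS]mulrC; apply: (le_trans (cosh_le _)).
  by rewrite ler_pM2l // ler_expR mulrC.
apply: (le_trans step).
have h1 j : j \notin s -> c' j = 0.
  rewrite /c'; have [//|ji] := eqVneq j i => js.
  by apply: c0; rewrite inE negb_or ji.
have h2 j f : `|flip_avg i Z f - flip_avg i Z (flip j f)| <= c' j.
  rewrite /c' /flip_avg; have [->|_] := eqVneq j i.
    by rewrite flipK [X in _ - X / _]addrC subrr normr0.
  have := infl j f; have := infl j (flip i f); rewrite (flipC j i).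
  rewrite !ler_norml => /andP[? ?] /andP[? ?].
  by apply/andP; split; lra.
have := IHs c' (flip_avg i Z) h1 h2; rewrite sum_flip_avg => IH.
have le_c : \sum_(j <- s) c' j ^+ 2 / 2 <= \sum_(j <- s) c j ^+ 2 / 2.
  apply: ler_sum => j _; rewrite /c'; case: eqP => // _.
  by rewrite expr0n mul0r divr_ge0 ?sqr_ge0.
apply: (@le_trans _ _ (expR (c i ^+ 2 / 2) * (#|{ffun I -> bool}|%:R *
    expR ((\sum_f Z f) / #|{ffun I -> bool}|%:R + \sum_(j <- s) c' j ^+ 2 / 2)))).
  by rewrite ler_pM2l ?expR_gt0.
rewrite mulrCA -expRD ler_wpM2l // ler_expR big_cons.
lra.
Qed.

(** The bounded-difference inequality, by Markov applied to
    [expR (t * (mean - Z))] with the optimal [t = lam / v]. *)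
Lemma bounded_difference (R : realType) (I : finType) (c : I -> R)
    (Z : {ffun I -> bool} -> R) (m v lam : R) :
  (forall i f, `|Z f - Z (flip i f)| <= c i) ->
  \sum_f Z f = #|{ffun I -> bool}|%:R * m ->
  \sum_i c i ^+ 2 <= v -> 0 < v -> 0 < lam ->
  #|[set f | Z f < m - lam]|%:R <=
    #|{ffun I -> bool}|%:R * expR (- (lam ^+ 2 / (2 * v))).
Proof.
move=> infl mean cv v0 l0; set N := #|{ffun I -> bool}|%:R.
have N0 : N != 0 by rewrite pnatr_eq0 card_ffun card_bool expn_eq0.
pose t := lam / v; have t0 : 0 < t by rewrite divr_gt0.
pose Y f := - (t * Z f).
have inflY i f : `|Y f - Y (flip i f)| <= t * c i.
  rewrite /Y -opprD normrN -mulrBr normrM gtr0_norm //.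
  by rewrite ler_pM2l.
have := @exp_moment_le _ _ (enum I) _ _ _ inflY.
have nil i : i \notin enum I -> t * c i = 0 by rewrite mem_enum.
move=> /(_ nil); rewrite -/N big_enum /=.
have -> : (\sum_f Y f) / N = - (t * m).
  by rewrite sumrN -mulr_sumr mean -/N; field.
move=> H.
have le1 : #|[set f | Z f < m - lam]|%:R * expR (- (t * (m - lam))) <=
    \sum_f expR (Y f).
  rewrite -sum1_card natr_sum mulr_suml [leRHS](bigID (mem [set f | Z f < m - lam])) /=.
  rewrite -[leLHS]addr0; apply: lerD; last first.
    by apply: sumr_ge0 => f _; apply: expR_ge0.
  apply: ler_sum => f; rewrite inE => hf; rewrite mul1r ler_expR /Y lerN2.
  by rewrite ler_pM2l // ltW.
have := le_trans le1 H; rewrite -ler_pdivlMr ?expR_gt0 // => /le_trans; apply.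
rewrite -mulrA -expRN -expRD ler_wpM2l ?ler0n // ler_expR opprK.
have -> : \sum_i (t * c i) ^+ 2 / 2 = t ^+ 2 / 2 * \sum_i c i ^+ 2.
  by rewrite mulr_sumr; apply: eq_bigr => i _; rewrite exprMn mulrAC.
have : t ^+ 2 / 2 * \sum_i c i ^+ 2 <= t ^+ 2 / 2 * v.
  by rewrite ler_wpM2l // divr_ge0 ?sqr_ge0.
have -> : t ^+ 2 / 2 * v = lam ^+ 2 / (2 * v) by rewrite /t; field; lra.
have -> : lam ^+ 2 / (2 * v) = t * lam / 2 by rewrite /t; field; lra.
lra.
Qed.

Definition monochromatic (I A : finType) (D : {set A}) (F : A -> {set I})
    (g : A -> bool) (f : {ffun I -> bool}) : {set A} :=
  [set a in D | [forall i in F a, f i == g a]].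

Lemma card_cylinder (I : finType) (F : {set I}) (b : bool) :
  #|[set f : {ffun I -> bool} | [forall i in F, f i == b]]| = (2 ^ #|~: F|)%N.
Proof.
pose P (i : I) : pred bool := if i \in F then pred1 b else predT.
have -> : #|[set f : {ffun I -> bool} | [forall i in F, f i == b]]| =
    #|(family P : simpl_pred {ffun I -> bool})|.
  apply: eq_card => f; rewrite inE; apply/forall_inP/familyP => [h i|h i iF].
    by rewrite /P; case: ifP => // /h; rewrite inE.
  by have := h i; rewrite /P iF inE.
rewrite card_family foldrE big_image /= (bigID (mem F)) /=.
rewrite big1 ?mul1n => [|i iF]; last by rewrite /P iF card1.
rewrite (eq_bigr (fun=> 2%N)) => [|i iF]; last first.
  by rewrite /P (negPf iF) card_bool.
by rewrite prod_nat_const; congr (2 ^ _)%N; apply: eq_card => i; rewrite !inE.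
Qed.

Lemma sum_monochromatic (R : realType) (I A : finType) (D : {set A})
    (F : A -> {set I}) (g : A -> bool) (N : nat) :
  (forall a, a \in D -> #|F a| = N) ->
  \sum_f #|monochromatic D F g f|%:R =
    #|{ffun I -> bool}|%:R * (#|D|%:R * 2 ^- N) :> R.
Proof.
move=> cF; rewrite -natr_sum.
transitivity ((\sum_(a in D) \sum_(f : {ffun I -> bool})
                 [forall i in F a, f i == g a])%:R : R).
  congr _%:R; rewrite exchange_big /=; apply: eq_bigr => f _.
  rewrite -sum1_card big_mkcond [RHS]big_mkcond /=; apply: eq_bigr => a _.
  by rewrite inE; case: (a \in D) => //=; case: [forall _ in _, _].
rewrite natr_sum -[#|D|%:R]/(#|D|%:R) -sum1_card natr_sum mulr_suml mulr_sumr.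
apply: eq_bigr => a /cF {}cF; rewrite mul1r.
have -> : (\sum_(f : {ffun I -> bool}) [forall i in F a, f i == g a])%N =
    #|[set f : {ffun I -> bool} | [forall i in F a, f i == g a]]|.
  rewrite -sum1_card [RHS]big_mkcond /=; apply: eq_bigr => f _.
  by rewrite inE; case: [forall _ in _, _].
rewrite card_cylinder card_ffun card_bool -(cardsC (F a)) cF expnD !natrM !natrX.
by rewrite mulrAC divff ?mul1r // expf_neq0 ?pnatr_eq0.
Qed.

Lemma sum_influence (I A : finType) (D : {set A}) (F : A -> {set I}) (N : nat) :
  (forall a, a \in D -> #|F a| = N) ->
  (\sum_i #|[set a in D | i \in F a]| = #|D| * N)%N.
Proof.
move=> cF.
transitivity (\sum_(a in D) \sum_i (i \in F a))%N.
  rewrite exchange_big /=; apply: eq_bigr => i _.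
  rewrite -sum1_card big_mkcond [RHS]big_mkcond /=; apply: eq_bigr => a _.
  by rewrite inE; case: (a \in D) => //=; case: (i \in F a).
rewrite -sum_nat_const; apply: eq_bigr => a /cF <-.
by rewrite -sum1_card [RHS]big_mkcond.
Qed.

(** The colour of an index influences only the items [a] whose [F a] contains
    this index, and these influences sum to [#|D| * N]; so the sum of their squares is at most the
    largest one times [#|D| * N].  Bounding the squares in this way leaves a
    single degree estimate [M] for the applications. *)
Lemma monochromatic_tail (R : realType) (I A : finType) (D : {set A})
    (F : A -> {set I}) (g : A -> bool) (N M : nat) (v lam : R) :
  (forall a, a \in D -> #|F a| = N) ->
  (forall i, #|[set a in D | i \in F a]| <= M)%N ->
  (M * (#|D| * N))%:R <= v -> 0 < v -> 0 < lam ->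
  #|[set f | #|monochromatic D F g f|%:R < #|D|%:R * 2 ^- N - lam]|%:R <=
    #|{ffun I -> bool}|%:R * expR (- (lam ^+ 2 / (2 * v))).
Proof.
move=> cF dM hv v0 l0.
apply: (@bounded_difference _ _ (fun i => #|[set a in D | i \in F a]|%:R)) => //.
- move=> i f.
  have le f1 : (#|monochromatic D F g f1| <=
      #|monochromatic D F g (flip i f1)| + #|[set a in D | i \in F a]|)%N.
    apply: leq_trans (leq_card_setU _ _); apply/subset_leq_card/subsetP => a.
    rewrite !inE => /andP[-> /forall_inP h] /=.
    have [//|iF] := boolP (i \in F a); first by rewrite orbT.
    rewrite orbF; apply/forall_inP => j jF; rewrite ffunE.
    have [ji|_] := eqVneq j i; last exact: h.
    by rewrite -ji jF in iF.
  have := le f; have := le (flip i f); rewrite flipK.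
  rewrite -!(ler_nat R) !natrD => h1 h2.
  by rewrite ler_norml; apply/andP; split; lra.
- exact: sum_monochromatic.
- apply: le_trans hv; rewrite -(sum_influence cF) natrM natr_sum mulr_sumr.
  by apply: ler_sum => i _; rewrite expr2 ler_wpM2r ?ler0n // ler_nat.
Qed.

(** * The parity hypergraph of a colouring *)

Definition lsets (T : finType) (l : nat) (e : {set T}) : {set {set T}} :=
  [set L : {set T} | L \subset e & #|L| == l].

Definition parity_edges (k l : nat) (T : finType) (X : {set T})
    (f : {ffun {set T} -> bool}) : {set {set T}} :=
  [set e : {set T} | (#|e| == k) && [forall L in lsets l e, f L == odd #|e :&: X|]].

Lemma parity_edges_uniform (k l : nat) (T : finType) (X : {set T})
    (f : {ffun {set T} -> bool}) (e : {set T}) :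
  e \in parity_edges k l X f -> #|e| = k.
Proof. by rewrite inE => /andP[/eqP]. Qed.

Definition parity_kgraph (k l : nat) (T : finType) (X : {set T})
    (f : {ffun {set T} -> bool}) : kgraph k T :=
  KGraph (@parity_edges_uniform k l T X f).

(** * Counting lemmas *)

Lemma union_bound (I T : finType) (P : pred I) (B : I -> {set T}) (A : {set T}) :
  (forall x, x \in A -> exists2 i, P i & x \in B i) ->
  (#|A| <= \sum_(i | P i) #|B i|)%N.
Proof.
move=> cov; have -> : (\sum_(i | P i) #|B i| = \sum_x \sum_(i | P i) (x \in B i))%N.
  rewrite exchange_big /=; apply: eq_bigr => i _.
  by rewrite -sum1_card big_mkcond.
rewrite -sum1_card big_mkcond /=; apply: leq_sum => x _.
case: ifP => // /cov[i Pi xB]; rewrite (bigD1 i) //= xB; exact: leq_addr.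
Qed.

Lemma card_lsets (T : finType) (l : nat) (e : {set T}) :
  #|lsets l e| = 'C(#|e|, l).
Proof. exact: cards_draws. Qed.

Lemma card_between (T : finType) (l : nat) (S e : {set T}) :
  S \subset e -> (#|S| <= l)%N ->
  #|[set L : {set T} | [&& S \subset L, L \subset e & #|L| == l]]| =
    'C(#|e| - #|S|, l - #|S|).
Proof.
move=> Se Sl.
have <- : #|e :\: S| = (#|e| - #|S|)%N by rewrite cardsD (setIidPr Se).
rewrite -cards_draws -[RHS](card_in_imset (f := fun A => A :|: S)).
  apply: eq_card => L; rewrite inE; apply/and3P/imsetP => [[SL Le /eqP cL]|[A]].
    exists (L :\: S); last by rewrite setUC -{1}(setIidPr SL) setID.
    by rewrite inE setSD // cardsD (setIidPr SL) cL eqxx.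
  rewrite inE subsetD => /andP[/andP[Ae AS] /eqP cA] ->.
  rewrite subsetUr subUset Ae Se; split=> //.
  rewrite cardsU (_ : A :&: S = set0) ?cards0 ?subn0 ?cA ?subnK //.
  by apply/eqP; rewrite setI_eq0.
move=> A B; rewrite !inE !subsetD => /andP[/andP[_ AS] _] /andP[/andP[_ BS] _].
move=> /(congr1 (fun Y => Y :&: ~: S)).
rewrite !disjoints_subset in AS BS.
by rewrite !setIUl setICr !setU0 (setIidPl AS) (setIidPl BS).
Qed.

Lemma card_supersets (T : finType) (k : nat) (S : {set T}) : (#|S| <= k)%N ->
  #|[set e : {set T} | S \subset e & #|e| == k]| = 'C(#|T| - #|S|, k - #|S|).
Proof.
move=> Sk; have := card_between (subsetT S) Sk; rewrite cardsT => <-.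
by apply: eq_card => e; rewrite !inE subsetT.
Qed.

Lemma bin_le_exp (n m : nat) : ('C(n, m) <= n ^ m)%N.
Proof.
apply: (@leq_trans (n ^_ m)).
  by rewrite -bin_ffact leq_pmulr ?fact_gt0.
elim: m n => [|m IHm] [|n] //.
rewrite ffactnS expnS leq_mul //; apply: leq_trans (IHm _) _.
by case: m {IHm} => // m; rewrite leq_exp2r.
Qed.

Lemma card_supersets_le (T : finType) (k : nat) (S : {set T}) :
  (#|[set e : {set T} | S \subset e & #|e| == k]| <= #|T| ^ (k - #|S|))%N.
Proof.
have [Sk|kS] := leqP #|S| k.
  rewrite card_supersets //; apply: leq_trans (bin_le_exp _ _) _.
  have [->|k0] := posnP (k - #|S|); first by rewrite !expn0.
  by rewrite leq_exp2r // leq_subr.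
rewrite (_ : [set _ | _ & _] = set0) ?cards0 //; apply/setP=> e; rewrite !inE.
apply/negbTE/negP=> /andP[/subset_leq_card Se /eqP ek].
by move: kS; rewrite ltnNge -ek Se.
Qed.

Lemma card_tuples_in (k : nat) (T : finType) (Y : 'I_k -> {set T}) :
  #|[set x : {ffun 'I_k -> T} | [forall i, x i \in Y i]]| =
    (\prod_i #|Y i|)%N.
Proof.
have -> : #|[set x : {ffun 'I_k -> T} | [forall i, x i \in Y i]]| =
    #|(family (fun i => mem (Y i)) : simpl_pred {ffun 'I_k -> T})|.
  by apply: eq_card => x; rewrite inE; apply/forallP/familyP.
by rewrite card_family foldrE big_image.
Qed.

Lemma card_tuples_fixed2 (k : nat) (T : finType) (i j : 'I_k) (u v : T) :
  i != j ->
  (#|[set x : {ffun 'I_k -> T} | (x i == u) && (x j == v)]| <= #|T| ^ (k - 2))%N.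
Proof.
move=> ij.
(* Fixing two coordinates means restricting them to singletons. *)
pose Y t := if t == i then [set u] else if t == j then [set v] else setT.
apply: (@leq_trans #|[set x : {ffun 'I_k -> T} | [forall t, x t \in Y t]]|).
  apply/subset_leq_card/subsetP => x; rewrite !inE => /andP[/eqP xi /eqP xj].
  apply/forallP => t; rewrite /Y; have [->|ti] := eqVneq t i; first by rewrite xi set11.
  by have [->|tj] := eqVneq t j; rewrite ?xj ?set11 ?inE.
rewrite card_tuples_in (bigD1 i) //= (bigD1 j) ?[j == _]eq_sym //=.
rewrite /Y eqxx [j == i]eq_sym (negPf ij) eqxx !cards1 !mul1n.
rewrite (eq_bigr (fun=> #|T|)) => [|t /andP[/negPf-> /negPf->]]; last by rewrite cardsT.
rewrite prod_nat_const leq_eqVlt; apply/orP; left; apply/eqP; congr (_ ^ _)%N.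
have := cardC (pred2 i j); rewrite card2 ij card_ord => /(congr1 (subn^~ 2)).
rewrite addKn => <-; apply: eq_card => t.
by rewrite !inE negb_or.
Qed.

Lemma card_tuples_through (k : nat) (T : finType) (L : {set T}) : (1 < #|L|)%N ->
  (#|[set x : {ffun 'I_k -> T} | L \subset [set x i | i : 'I_k]]|
     <= k ^ 2 * #|T| ^ (k - 2))%N.
Proof.
move=> /card_gt1P[u [v [uL vL uv]]].
pose B (p : 'I_k * 'I_k) := [set x : {ffun 'I_k -> T} | (x p.1 == u) && (x p.2 == v)].
apply: (@leq_trans (\sum_(p : 'I_k * 'I_k | p.1 != p.2) #|B p|)%N).
  apply: union_bound => x; rewrite inE => /subsetP h.
  have /imsetP[i _ ui] := h _ uL; have /imsetP[j _ vj] := h _ vL.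
  exists (i, j); last by rewrite inE /= -ui -vj !eqxx.
  by apply: contraNneq uv => /= ij; rewrite ui vj ij.
apply: (@leq_trans (\sum_(p : 'I_k * 'I_k | p.1 != p.2) #|T| ^ (k - 2))%N).
  by apply: leq_sum => p hp; apply: card_tuples_fixed2.
rewrite sum_nat_const leq_mul2r; apply/orP; right.
apply: leq_trans (max_card _) _.
by rewrite card_prod card_ord.
Qed.

Lemma card_tuples_noninj (k : nat) (T : finType) : (1 < k)%N ->
  (#|[set x : {ffun 'I_k -> T} | ~~ injectiveb x]| <= k ^ 2 * #|T| ^ (k - 1))%N.
Proof.
move=> k1.
pose B (q : ('I_k * 'I_k) * T) :=
  [set x : {ffun 'I_k -> T} | (x q.1.1 == q.2) && (x q.1.2 == q.2)].
apply: (@leq_trans (\sum_(q | q.1.1 != q.1.2) #|B q|)%N).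
  apply: union_bound => x; rewrite inE => /injectivePn[i [j ij xij]].
  by exists ((i, j), x i) => //; rewrite inE /= xij !eqxx.
apply: (@leq_trans (\sum_(q : ('I_k * 'I_k) * T | q.1.1 != q.1.2) #|T| ^ (k - 2))%N).
  by apply: leq_sum => p hp; apply: card_tuples_fixed2.
rewrite sum_nat_const; apply: (@leq_trans (k ^ 2 * #|T| * #|T| ^ (k - 2))%N).
  rewrite leq_mul2r; apply/orP; right.
  by apply: leq_trans (max_card _) _; rewrite !card_prod card_ord.
by rewrite -mulnA -expnS (_ : (k - 2).+1 = k - 1)%N //; lia.
Qed.

(** * Density *)

(** Injective tuples of [Y] become edges with probability [2 ^- 'C(k, l)] each,
    and the tuples with a repetition are too few to matter.  An [l]-set with
    [2 <= l] lies in the image of [O(n ^ (k - 2))] tuples only, so the failure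
    probability is [expR (- c * n ^ 2)]: small enough to survive a union bound
    over the [2 ^ (n * k)] choices of [Y]. *)
Lemma edge_tuples_tail (R : realType) (k l : nat) (T : finType) (X : {set T})
    (Y : 'I_k -> {set T}) (mu : R) :
  (2 <= l)%N -> (l <= k)%N -> (0 < #|T|)%N -> 0 < mu ->
  2 * k%:R ^+ 2 <= mu * #|T|%:R ->
  #|[set f | (edge_tuples (parity_kgraph k l X f) Y)%:R <
        2 ^- 'C(k, l) * (\prod_(i < k) #|Y i|%:R) - mu * #|T|%:R ^+ k]|%:R <=
    #|{ffun {set T} -> bool}|%:R
      * expR (- (mu ^+ 2 / (8 * k%:R ^+ 2 * 'C(k, l)%:R) * #|T|%:R ^+ 2)).
Proof.
move=> l2 lk; set n := #|T| => n0 mu0 nlarge.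
have nR0 : 0 < n%:R :> R by rewrite ltr0n.
have kR0 : 0 < k%:R :> R by rewrite ltr0n; lia.
have cR0 : 0 < 'C(k, l)%:R :> R by rewrite ltr0n bin_gt0.
pose im (x : {ffun 'I_k -> T}) := [set x i | i : 'I_k].
pose D := [set x : {ffun 'I_k -> T} | injectiveb x && [forall i, x i \in Y i]].
pose F (x : {ffun 'I_k -> T}) := lsets l (im x).
pose g (x : {ffun 'I_k -> T}) := odd #|im x :&: X|.
have card_im x : x \in D -> #|im x| = k.
  by rewrite inE => /andP[/injectiveP xi _]; rewrite card_imset // card_ord.
have cF x : x \in D -> #|F x| = 'C(k, l) by move=> xD; rewrite card_lsets card_im.
have dM L : (#|[set x in D | L \in F x]| <= k ^ 2 * n ^ (k - 2))%N.
  have [/eqP Ll|Ll] := boolP (#|L| == l); last first.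
    rewrite (_ : [set _ in _ | _] = set0) ?cards0 //; apply/setP => x.
    by rewrite !inE (negPf Ll) !andbF.
  apply: leq_trans (card_tuples_through (L := L) _ _); last by rewrite Ll.
  apply/subset_leq_card/subsetP => x; rewrite !inE.
  by case/andP=> _ /andP[].
have Dn : (#|D| <= n ^ k)%N by apply: leq_trans (max_card _) _; rewrite card_ffun card_ord.
pose v : R := k%:R ^+ 2 * n%:R ^+ (k - 2) * (n%:R ^+ k * 'C(k, l)%:R).
have hv : (k ^ 2 * n ^ (k - 2) * (#|D| * 'C(k, l)))%:R <= v.
  rewrite /v -!natrX -!natrM ler_nat leq_mul2l; apply/orP; right.
  by rewrite leq_mul2r Dn orbT.
have v0 : 0 < v by rewrite !mulr_gt0 ?exprn_gt0.
have lam0 : 0 < mu / 2 * n%:R ^+ k by rewrite mulr_gt0 ?divr_gt0 ?exprn_gt0.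
have nk : n%:R ^+ k = n%:R ^+ (k - 2) * n%:R ^+ 2 :> R by rewrite -exprD subnK //; lia.
have nk1 : n%:R ^+ k = n%:R ^+ (k - 1) * n%:R :> R by rewrite -exprSr subn1 prednK //; lia.
have := monochromatic_tail g cF dM hv v0 lam0.
have -> : (mu / 2 * n%:R ^+ k) ^+ 2 / (2 * v) =
    mu ^+ 2 / (8 * k%:R ^+ 2 * 'C(k, l)%:R) * n%:R ^+ 2.
  rewrite /v nk; field.
  by rewrite !lt0r_neq0 ?exprn_gt0.
apply: le_trans; rewrite ler_nat; apply/subset_leq_card/subsetP => f.
rewrite !inE => bad; apply: le_lt_trans (lt_le_trans bad _).
  rewrite ler_nat; apply/subset_leq_card/subsetP => x.
  rewrite !inE => /andP[/andP[xi xY] xm]; rewrite xY /= xm andbT.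
  by apply/eqP/card_im; rewrite inE xi.
have : (\prod_i #|Y i| <= #|D| + k ^ 2 * n ^ (k - 1))%N.
  rewrite -card_tuples_in.
  apply: leq_trans (leq_add (leqnn _) (card_tuples_noninj _ _)); last lia.
  apply: leq_trans (leq_card_setU _ _); apply/subset_leq_card/subsetP => x.
  by rewrite !inE => ->; case: injectiveb.
rewrite -(ler_nat R) natrD natrM natr_prod !natrX.
have p0 : 0 < 2 ^- 'C(k, l) :> R by rewrite invr_gt0 exprn_gt0.
have p1 : 2 ^- 'C(k, l) <= 1 :> R.
  by rewrite invf_le1 ?exprn_gt0 // exprn_ege1 // ler1n.
have a0 : 0 <= n%:R ^+ (k - 1) :> R by rewrite exprn_ge0 ?ler0n.
have : 2 * k%:R ^+ 2 * n%:R ^+ (k - 1) <= mu * n%:R ^+ k.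
  by have := ler_wpM2r a0 nlarge; rewrite nk1; lra.
move: p0 p1; set p := _ ^- _; set P := \prod_(i < k) _; set a := _ ^+ (k - 1) => *.
have : p * P <= p * (#|D|%:R + k%:R ^+ 2 * a) by rewrite ler_wpM2l // ltW.
have : p * (k%:R ^+ 2 * a) <= 1 * (k%:R ^+ 2 * a).
  by rewrite ler_wpM2r // mulr_ge0 // sqr_ge0.
lra.
Qed.

(** * Degrees of [l]-sets *)

Definition parity_sign (R : pzRingType) (T : finType) (X e : {set T}) : R :=
  (-1) ^+ #|e :&: X|.

Lemma parity_signU1 (R : pzRingType) (T : finType) (X e : {set T}) (x : T) :
  x \notin e ->
  parity_sign R X (x |: e) = parity_sign R X e * (-1) ^+ (x \in X).
Proof.
move=> xe; rewrite /parity_sign -exprD; congr (_ ^+ _).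
rewrite setIUl; have [xX|xX] := boolP (x \in X).
  rewrite (setIidPl _) ?sub1set // cardsU1 inE (negPf xe) /=.
  by rewrite addnC.
rewrite (_ : [set x] :&: X = set0) ?set0U ?addn0 //.
by apply/eqP; rewrite setI_eq0 disjoints1.
Qed.

(** Each [e] arises from [m.+1] of the sets [B] by adding one vertex, and the
    sign is multiplicative. *)
Lemma sum_parity_sign_step (R : pzRingType) (T : finType) (X S : {set T}) (m : nat) :
  (\sum_(e : {set T} | (S \subset e) && (#|e| == #|S| + m.+1)%N) parity_sign R X e)
      *+ m.+1 =
  \sum_(B : {set T} | (S \subset B) && (#|B| == #|S| + m)%N)
    parity_sign R X B * \sum_(x | x \notin B) (-1) ^+ (x \in X).
Proof.
under [RHS]eq_bigr => B _ do rewrite mulr_sumr.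
rewrite -sumrMnl pair_big_dep /=.
transitivity (\sum_(e : {set T} | (S \subset e) && (#|e| == #|S| + m.+1)%N)
   \sum_(x in e :\: S) parity_sign R X e).
  apply: eq_bigr => e /andP[Se /eqP ce]; rewrite sumr_const cardsD (setIidPr Se) ce.
  by rewrite addKn.
rewrite pair_big_dep /=.
rewrite (reindex_onto (fun p : {set T} * T => (p.2 |: p.1, p.2))
                      (fun p : {set T} * T => (p.1 :\ p.2, p.2))) /=; last first.
  move=> [e x] /=; rewrite inE => /andP[_ /andP[_ xe]].
  by rewrite setD1K.
apply: eq_big => [[B x]|[B x]] /=; last first.
  rewrite inE xpair_eqE eqxx andbT => /andP[_ /eqP BE].
  by rewrite parity_signU1 // -BE !inE eqxx.
rewrite !inE eqxx /= andbT xpair_eqE eqxx andbT.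
have [xB|xB] /= := boolP (x \in B).
  rewrite andbF; apply/negbTE; rewrite !negb_and; apply/orP; right.
  by apply: contraL xB => /eqP <-; rewrite !inE eqxx.
rewrite setU1K // eqxx !andbT cardsU1 xB addnS eqSS.
have [xS|xS] /= := boolP (x \in S).
  rewrite andbF; apply/esym/negbTE; apply/negP => /andP[/subsetP/(_ _ xS)].
  by rewrite (negPf xB).
rewrite andbT; congr (_ && _).
apply/idP/idP => /subsetP h; apply/subsetP => y yS; last by rewrite inE h ?orbT.
have := h _ yS; rewrite !inE => /predU1P[yx|//].
by rewrite yx (negPf xS) in yS.
Qed.

(** In the previous identity each inner sum is bounded: it is the sum of all
    vertex signs, which is small as [X] is balanced, without those of the
    [#|S| + m] vertices of [B].  So only the [O(n ^ m)] sets [B] count. *)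
Lemma sum_parity_sign_le (R : realType) (T : finType) (X S : {set T}) (m : nat) :
  `| \sum_x (-1) ^+ (x \in X) | <= 2 :> R ->
  `| \sum_(e : {set T} | (S \subset e) && (#|e| == #|S| + m.+1)%N) parity_sign R X e |
    <= (#|S| + m + 2)%:R * #|T|%:R ^+ m.
Proof.
move=> bal; set Z := \sum_(e | _) _.
have sgn1 B : `|parity_sign R X B| = 1 by rewrite /parity_sign normrX normrN1 expr1n.
have : `|Z *+ m.+1| <= (#|S| + m + 2)%:R * #|T|%:R ^+ m.
  rewrite sum_parity_sign_step; apply: (le_trans (ler_norm_sum _ _ _)).
  apply: (@le_trans _ _ (\sum_(B : {set T} | (S \subset B) && (#|B| == #|S| + m)%N)
            (#|S| + m + 2)%:R)).
    apply: ler_sum => B /andP[_ /eqP cB]; rewrite normrM sgn1 mul1r.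
    have -> : \sum_(x | x \notin B) (-1) ^+ (x \in X) =
        \sum_x (-1) ^+ (x \in X) - \sum_(x in B) (-1) ^+ (x \in X) :> R.
      by rewrite [X in X - _](bigID (mem B)) /= addrAC subrr add0r.
    apply: (le_trans (ler_normB _ _)); rewrite natrD [leRHS]addrC; apply: lerD => //.
    apply: (le_trans (ler_norm_sum _ _ _)); rewrite -cB -sum1_card natr_sum.
    by apply: ler_sum => x _; rewrite normrX normrN1 expr1n.
  rewrite sumr_const -[_ *+ _]mulr_natr ler_wpM2l // -natrX ler_nat.
  apply: (@leq_trans #|[set B : {set T} | S \subset B & #|B| == (#|S| + m)%N]|).
    by apply/subset_leq_card/subsetP => B; rewrite !inE.
  by apply: leq_trans (card_supersets_le _ _) _; rewrite addKn.
apply: le_trans; rewrite normrMn mulrSr lerDr.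

by rewrite mulrn_wge0.
Qed.

Lemma card_parity_supersets (R : realType) (T : finType) (X S : {set T}) (k : nat)
    (b : bool) :
  (#|S| < k)%N -> `| \sum_x (-1) ^+ (x \in X) | <= 2 :> R ->
  'C(#|T| - #|S|, k - #|S|)%:R - (k + 2)%:R * #|T|%:R ^+ (k - #|S|).-1 <=
    2 * #|[set e : {set T} |
          [&& S \subset e, #|e| == k & odd #|e :&: X| == b]]|%:R :> R.
Proof.
move=> Sk bal.
have := sum_parity_sign_le S (k - #|S|).-1 bal.
have e1 : (#|S| + (k - #|S|).-1.+1 = k)%N by lia.
rewrite e1 => H.
have {}H := le_trans H (ler_wpM2r _ (_ : (_ <= (k + 2)%:R))).
have {}H : `|\sum_(e : {set T} | (S \subset e) && (#|e| == k)) parity_sign R X e| <=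
    (k + 2)%:R * #|T|%:R ^+ (k - #|S|).-1.
  by apply: H; rewrite ?exprn_ge0 ?ler0n // ler_nat; lia.
rewrite -(card_supersets (ltnW Sk)).
set W := [set e : {set T} | _ & _].
have <- : \sum_(e in W) (1 + (-1) ^+ b * parity_sign R X e) =
    2 * #|[set e : {set T} |
          [&& S \subset e, #|e| == k & odd #|e :&: X| == b]]|%:R.
  rewrite -sum1_card natr_sum mulr_sumr big_mkcond [RHS]big_mkcond /=.
  apply: eq_bigr => e _; rewrite !inE andbA; case: ifP => //= _.
  rewrite /parity_sign -[(-1) ^+ #|_|]signr_odd.
  by case: (odd _) b => [] []; rewrite /= ?expr0 ?expr1; lra.
rewrite big_split /= sumr_const -mulr_sumr; apply: lerD => //.
rewrite (eq_bigl (fun e : {set T} => (S \subset e) && (#|e| == k))); last first.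
  by move=> e; rewrite inE.
apply: lerNnormlW.
by rewrite normrM normrX normrN1 expr1n mul1r.
Qed.

(** The colour [b] of [S] itself is held fixed: it would otherwise influence
    every edge through [S].  Any other [l]-set contains a vertex outside [S], so
    it lies in at most [n ^ (k - l - 1)] of the edges through [S].  Fixing [b]
    restricts the edges to those of parity [b], half of the total, and saves one
    factor [1 / 2] of the probability, so the expected degree is the same for
    both values of [b]. *)
Lemma degree_tail (R : realType) (k l : nat) (T : finType) (X S : {set T}) (eps : R) :
  (l < k)%N -> #|S| = l -> (0 < #|T|)%N -> 0 < eps ->
  `| \sum_x (-1) ^+ (x \in X) | <= 2 :> R ->
  2 * (k + 2)%:R <= eps * #|T|%:R ->
  #|[set f | (degree (parity_kgraph k l X f) S)%:R <
        2 ^- 'C(k, l) * 'C(#|T| - l, k - l)%:R - eps * #|T|%:R ^+ (k - l)]|%:R <=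
    #|{ffun {set T} -> bool}|%:R
      * (2 * expR (- (eps ^+ 2 / (8 * 'C(k, l)%:R) * #|T|%:R))).
Proof.
move=> lk cS; set n := #|T| => n0 eps0 bal nlarge.
have nR0 : 0 < n%:R :> R by rewrite ltr0n.
have C0 : (0 < 'C(k, l))%N by rewrite bin_gt0 ltnW.
have cR0 : 0 < 'C(k, l)%:R :> R by rewrite ltr0n.
pose D (b : bool) := [set e : {set T} |
  [&& S \subset e, #|e| == k & odd #|e :&: X| == b]].
pose F (e : {set T}) := lsets l e :\ S.
have cF b e : e \in D b -> #|F e| = 'C(k, l).-1.
  rewrite inE => /and3P[Se /eqP ce _].
  have := cardsD1 S (lsets l e).
  by rewrite card_lsets ce inE Se cS eqxx /= => ->.
have dM b L : (#|[set e in D b | L \in F e]| <= n ^ (k - l).-1)%N.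
  have [/eqP cL|cL] := boolP (#|L| == l); last first.
    rewrite (_ : [set _ in _ | _] = set0) ?cards0 //; apply/setP => x.
    by rewrite !inE (negPf cL) !andbF.
  have [->|LS] := eqVneq L S.
    rewrite (_ : [set _ in _ | _] = set0) ?cards0 //; apply/setP => x.
    by rewrite !inE eqxx !andbF.
  have [u uL uS] : exists2 u, u \in L & u \notin S.
    apply/subsetPn; apply: contra LS => LS.
    by rewrite eqEcard LS cL cS /=.
  have -> : (k - l).-1 = (k - #|u |: S|)%N by rewrite cardsU1 uS cS; lia.
  apply: leq_trans (card_supersets_le _ _).
  apply/subset_leq_card/subsetP => e; rewrite !inE.
  case/andP=> /and3P[Se -> _] /and3P[_ /subsetP Le _].
  by rewrite subUset sub1set Le // Se.
have Dn b : (#|D b| <= n ^ (k - l))%N.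
  rewrite -cS; apply: leq_trans (card_supersets_le _ _).
  by apply/subset_leq_card/subsetP => e; rewrite !inE => /and3P[-> ->].
pose v : R := n%:R ^+ (k - l).-1 * (n%:R ^+ (k - l) * 'C(k, l)%:R).
have hv b : (n ^ (k - l).-1 * (#|D b| * 'C(k, l).-1))%:R <= v.
  rewrite /v -!natrX -!natrM ler_nat leq_mul2l; apply/orP; right.
  by rewrite leq_mul // leq_pred.
have v0 : 0 < v by rewrite !mulr_gt0 ?exprn_gt0.
have lam0 : 0 < eps / 2 * n%:R ^+ (k - l) by rewrite mulr_gt0 ?divr_gt0 ?exprn_gt0.
have nm : n%:R ^+ (k - l) = n%:R ^+ (k - l).-1 * n%:R :> R.
  by rewrite -exprSr prednK // subn_gt0.
have tail b := monochromatic_tail (fun=> b) (cF b) (dM b) (hv b) v0 lam0.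
move: tail.
have -> : (eps / 2 * n%:R ^+ (k - l)) ^+ 2 / (2 * v) =
    eps ^+ 2 / (8 * 'C(k, l)%:R) * n%:R.
  by rewrite /v nm; field; rewrite !lt0r_neq0 ?exprn_gt0.
pose bad b := [set f | #|monochromatic (D b) F (fun=> b) f|%:R <
  #|D b|%:R * 2 ^- 'C(k, l).-1 - eps / 2 * n%:R ^+ (k - l)].
move=> tail; apply: (@le_trans _ _ (\sum_b #|bad b|)%:R).
  rewrite ler_nat; apply: union_bound => f; rewrite inE => degf.
  (* The only bound that matters is the one for the actual colour of [S]. *)
  exists (f S) => //; rewrite inE; apply: le_lt_trans (lt_le_trans degf _).
    rewrite ler_nat; apply/subset_leq_card/subsetP => e.
    rewrite !inE => /andP[/and3P[-> -> /eqP ->] /forall_inP mono] /=.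
    rewrite andbT; apply/forall_inP => L Le; have [->//|LS] := eqVneq L S.
    by apply: mono; rewrite !inE LS; move: Le; rewrite inE.
  have := @card_parity_supersets R T X S k (f S); rewrite cS -/n => /(_ lk bal).
  rewrite -/(D (f S)) -[X in 2 ^- X](prednK C0) exprS invfM.
  have a0 : 0 <= n%:R ^+ (k - l).-1 :> R by rewrite exprn_ge0 ?ler0n.
  have := ler_wpM2r a0 nlarge; rewrite nm.
  have p0 : 0 < 2 ^- 'C(k, l).-1 :> R by rewrite invr_gt0 exprn_gt0.
  have p1 : 2 ^- 'C(k, l).-1 <= 1 :> R.
    by rewrite invf_le1 ?exprn_gt0 // exprn_ege1 // ler1n.
  move: p0 p1 a0; set p := _ ^- _; set a := _ ^+ (k - l).-1 => p0 p1 a0 h1 h2.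
  have := ler_wpM2l (ltW p0) h2.
  have : p * ((k + 2)%:R * a) <= 1 * ((k + 2)%:R * a).
    by rewrite ler_wpM2r // mulr_ge0 // ler0n.
  have : 0 <= (k + 2)%:R * a by rewrite mulr_ge0 ?ler0n.
  lra.
rewrite big_bool natrD; have := tail true; have := tail false.
rewrite /bad; lra.
Qed.

(** * From [l]-sets to smaller sets *)

Lemma sum_degree_supersets (k l : nat) (T : finType) (H : kgraph k T) (S : {set T}) :
  (#|S| <= l)%N ->
  (\sum_(L : {set T} | (S \subset L) && (#|L| == l)) degree H L =
     degree H S * 'C(k - #|S|, l - #|S|))%N.
Proof.
move=> Sl.
transitivity (\sum_(L : {set T} | (S \subset L) && (#|L| == l))
    \sum_(e in edges H) (L \subset e))%N.
  apply: eq_bigr => L _; rewrite /degree -sum1_card big_mkcond [RHS]big_mkcond /=.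
  by apply: eq_bigr => e _; rewrite inE; case: (e \in edges H).
rewrite exchange_big /= /degree -sum1_card big_distrl /=.
rewrite [RHS](eq_bigl (fun e => (e \in edges H) && (S \subset e))); last first.
  by move=> e; rewrite inE.
rewrite big_mkcondr; apply: eq_bigr => e eH; rewrite mul1n.
case: ifP => Se; last first.
  rewrite big1 // => L /andP[SL _]; apply/eqP; rewrite eqb0.
  by apply: contraFN Se; apply: subset_trans.
rewrite -(edges_uniform eH) -card_between // -sum1_card big_mkcond [RHS]big_mkcond /=.
by apply: eq_bigr => L _; rewrite inE andbCA andbA; case: ifP => h;
   rewrite ?andbT ?andbF; case: (L \subset e) h => //= ->.
Qed.

Lemma bin_trinomial (n k l j : nat) : (j <= l)%N -> (l <= k)%N -> (k <= n)%N ->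
  ('C(n - j, l - j) * 'C(n - l, k - l) = 'C(n - j, k - j) * 'C(k - j, l - j))%N.
Proof.
move=> jl lk kn.
have e1 := @bin_fact (n - j) (l - j) ltac:(lia).
have e2 := @bin_fact (n - l) (k - l) ltac:(lia).
have e3 := @bin_fact (n - j) (k - j) ltac:(lia).
have e4 := @bin_fact (k - j) (l - j) ltac:(lia).
have s1 : (n - j - (l - j) = n - l)%N by lia.
have s2 : (n - l - (k - l) = n - k)%N by lia.
have s3 : (n - j - (k - j) = n - k)%N by lia.
have s4 : (k - j - (l - j) = k - l)%N by lia.
rewrite s1 in e1; rewrite s2 in e2; rewrite s3 in e3; rewrite s4 in e4.
have p : (0 < (l - j)`! * (k - l)`! * (n - k)`!)%N by rewrite !muln_gt0 !fact_gt0.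
apply/eqP; rewrite -(eqn_pmul2r p); apply/eqP.
transitivity (n - j)`!; first by rewrite -e1 -e2; ring.
by rewrite -e3 -e4; ring.
Qed.

(** Average over the [l]-sets containing [S]: each edge through [S] contains
    ['C(k - #|S|, l - #|S|)] of them, and by [bin_trinomial] the main terms match
    exactly. *)
Lemma degree_ge_of_supersets (R : realType) (k l : nat) (T : finType)
    (H : kgraph k T) (S : {set T}) (p eps : R) :
  (#|S| <= l)%N -> (l <= k)%N -> (k <= #|T|)%N -> 0 <= eps ->
  (forall L : {set T}, #|L| = l ->
     p * 'C(#|T| - l, k - l)%:R - eps * #|T|%:R ^+ (k - l) <= (degree H L)%:R) ->
  p * 'C(#|T| - #|S|, k - #|S|)%:R - eps * #|T|%:R ^+ (k - #|S|)
    <= (degree H S)%:R.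
Proof.
move=> Sl lk kn e0 hL; set j := #|S|; set n := #|T|.
have c1 : 1 <= 'C(k - j, l - j)%:R :> R by rewrite ler1n bin_gt0 leq_sub2r.
have c0 := lt_le_trans ltr01 c1.
rewrite -(ler_pM2r c0) -natrM -sum_degree_supersets // natr_sum.
have : \sum_(L : {set T} | (S \subset L) && (#|L| == l))
     (p * 'C(n - l, k - l)%:R - eps * n%:R ^+ (k - l)) <=
   \sum_(L : {set T} | (S \subset L) && (#|L| == l)) (degree H L)%:R.
  by apply: ler_sum => L /andP[_ /eqP]; apply: hL.
apply: le_trans; rewrite sumr_const.
have -> : #|[pred L : {set T} | (S \subset L) && (#|L| == l)]| = 'C(n - j, l - j).
  by rewrite -card_supersets //; apply: eq_card => L; rewrite !inE.
rewrite -[leRHS]mulr_natr !mulrBl -!mulrA -!natrM [('C(n - l, _) * _)%N]mulnC bin_trinomial //.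
rewrite lerD2l lerN2 ler_wpM2l //.
apply: (@le_trans _ _ (n%:R ^+ (k - j))); last first.
  by rewrite ler_peMr // exprn_ge0 ?ler0n.
rewrite -!natrX -natrM ler_nat.
rewrite (_ : k - j = (k - l) + (l - j))%N; last by lia.
rewrite expnD leq_mul2l; apply/orP; right; apply: leq_trans (bin_le_exp _ _) _.
by case: (l - j)%N => [|s]; rewrite ?expn0 // leq_exp2r // leq_subr.
Qed.

Lemma min_degree_ge (R : realType) (k j : nat) (T : finType) (H : kgraph k T) (B : R) :
  (j <= #|T|)%N -> (forall S : {set T}, #|S| = j -> B <= (degree H S)%:R) ->
  B <= (min_degree H j)%:R.
Proof.
move=> jT hS; apply: (big_ind (fun x : nat => B <= x%:R)).
- have /card_gt0P[S] : (0 < #|[set S : {set T} | #|S| == j]|)%N.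
    by rewrite card_draws bin_gt0.
  rewrite inE => /eqP/hS/le_trans; apply; rewrite ler_nat.
  by apply/subset_leq_card/subsetP => e; rewrite inE => /andP[].
- by move=> x y hx hy; rewrite /minn; case: ifP.
- by move=> S /eqP; apply: hS.
Qed.

Lemma bin_subn_ge (n r j : nat) : (j <= n)%N ->
  ('C(n, r.+1) <= 'C(n - j, r.+1) + j * n ^ r)%N.
Proof.
elim: j => [|j IHj] jn; first by rewrite subn0 leq_addr.
apply: leq_trans (IHj (ltnW jn)) _.
have -> : (n - j = (n - j.+1).+1)%N by lia.
rewrite binS mulSn -addnA leq_add2l leq_add2r.
apply: leq_trans (bin_le_exp _ _) _.
by case: r {IHj} => [|r]; rewrite ?expn0 // leq_exp2r // leq_subr.
Qed.

Lemma exp_le_bin (n r : nat) : (2 * r <= n)%N -> (n ^ r <= 2 ^ r * r`! * 'C(n, r))%N.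
Proof.
move=> rn; rewrite -mulnA [(r`! * _)%N]mulnC bin_ffact.
have ge : forall m s : nat, ((m - s) ^ s <= m ^_ s)%N.
  move=> m s; elim: s m => [|s IHs] [|m] //; first by rewrite sub0n exp0n.
  by rewrite ffactnS expnS subSS leq_mul // (leq_trans (leq_subr _ _)).
apply: leq_trans (leq_mul (leqnn _) (ge n r)).
rewrite -expnMn; case: r rn ge => // r rn _; rewrite leq_exp2r //; lia.
Qed.

(** * No Hamilton cycle *)

Lemma odd_count_blocks (T : Type) (a : pred T) (b : bool) (k m : nat) (w : seq T) :
  size w = (m * k)%N ->
  (forall j, (j < m)%N -> odd (count a (take k (drop (j * k) w))) = b) ->
  odd (count a w) = odd m && b.
Proof.
elim: m w => [|m IHm] w sw hb; first by rewrite (size0nil sw).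
rewrite -(cat_take_drop k w) count_cat oddD.
have := hb 0%N (ltn0Sn _); rewrite mul0n drop0 => ->.
rewrite (IHm (drop k w)) ?size_drop ?sw ?mulSn ?addKn // => [|j jm].
  by rewrite /=; move: (odd m) b {hb IHm} => [] [].
by rewrite drop_drop addnC -mulSn hb.
Qed.

Lemma rot_overlap (T : finType) (k d : nat) (w : seq T) :
  uniq w -> (k <= size w)%N -> (d <= k)%N ->
  (k - d <= #|[set x in take k w] :&: [set x in take k (rot d w)]|)%N.
Proof.
move=> uw kw dk; set A := take (k - d) (drop d w).
have sA : size A = (k - d)%N by rewrite size_takel // size_drop leq_sub2r.
have uA : uniq A by rewrite take_uniq // drop_uniq.
rewrite -{1}sA -(card_uniqP uA); apply/subset_leq_card/subsetP => x xA.
rewrite !inE; apply/andP; split.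
  by move: xA; rewrite /A take_drop subnK // => /mem_drop.
rewrite /rot; have xA' : x \in take (k - d) (take k (drop d w ++ take d w)).
  by rewrite take_takel ?leq_subr // takel_cat // size_drop leq_sub2r.
exact: mem_take xA'.
Qed.

Lemma segment_gap (T : finType) (k l d p q : nat) (s : seq T) :
  uniq s -> (k <= size s)%N -> rot q s = rot d (rot p s) ->
  #|segment k s p :&: segment k s q| = l -> (k - l <= d)%N.
Proof.
move=> us ks rq cl; have [kd|dk] := leqP k d; first by rewrite (leq_trans (leq_subr _ _)).
have := @rot_overlap T k d (rot p s); rewrite rot_uniq size_rot -rq.
by move=> /(_ us ks (ltnW dk)); rewrite -/(segment k s p) -/(segment k s q) cl; lia.
Qed.

Lemma next_nth_head (P : seq nat) (i : nat) : uniq P -> (i < size P)%N ->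
  next P (nth 0%N P i) = nth (head 0 P) P i.+1.
Proof.
move=> uP iP; rewrite next_nth mem_nth // index_uniq //.
by case: P uP iP.
Qed.

(** Consecutive edges start at least [k - l] positions apart, also around the
    end of the ordering, since otherwise they would share more than [l]
    vertices.  There are [n / (k - l)] edges, so all these gaps are tight. *)
Lemma cycle_positions (T : finType) (k l : nat) (s : seq T) (P : seq nat) :
  uniq s -> (k <= size s)%N -> sorted ltn P ->
  (forall p, p \in P -> (p < size s)%N) ->
  (forall p, p \in P -> #|segment k s p :&: segment k s (next P p)| = l) ->
  (size s <= size P * (k - l))%N ->
  forall i, (i < size P)%N -> nth 0%N P i = (nth 0%N P 0 + i * (k - l))%N.
Proof.
move=> us ks sP ltP capP szP.
have uP : uniq P by apply: sorted_uniq sP; [apply: ltn_trans | apply: ltnn].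
have memP i : (i < size P)%N -> nth 0%N P i \in P by apply: mem_nth.
have step i : (i.+1 < size P)%N -> (nth 0%N P i + (k - l) <= nth 0%N P i.+1)%N.
  move=> iP; have iP' := ltnW iP.
  have lt : (nth 0%N P i < nth 0%N P i.+1)%N.
    by apply: (sorted_ltn_nth ltn_trans) => //; rewrite inE.
  have := capP _ (memP _ iP'); rewrite next_nth_head // (set_nth_default 0%N) //.
  have rq : rot (nth 0%N P i.+1) s =
      rot (nth 0%N P i.+1 - nth 0%N P i)%N (rot (nth 0%N P i) s).
    by rewrite -rotD subnK ?(ltnW lt) // ltnW // ltP // memP.
  by move/(segment_gap us ks rq); lia.
have low i : (i < size P)%N -> (nth 0%N P 0 + i * (k - l) <= nth 0%N P i)%N.
  elim: i => [|i IHi] iP; first by rewrite addn0.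
  by have := step _ iP; have := IHi (ltnW iP); rewrite mulSn; lia.
(* Indexed by the distance [j] to the last edge. *)
have high j i : (i + j.+1 = size P)%N ->
    (nth 0%N P i + j.+1 * (k - l) <= nth 0%N P 0 + size s)%N.
  elim: j i => [|j IHj] i ij; last first.
    have iP : (i.+1 < size P)%N by lia.
    have := step _ iP; have := IHj i.+1 ltac:(lia); rewrite !mulSn; lia.
  have iP : (i < size P)%N by lia.
  (* The last edge is followed by the first one, so [head 0 P] is read here as
     the default value of [nth]. *)
  have := capP _ (memP _ iP); rewrite next_nth_head // [nth (head _ _) _ _]nth_default;
    last by rewrite -ij addn1.
  rewrite -nth0 mul1n.
  have h0 := low _ iP; have h1 := ltP _ (memP _ iP).
  have rq : rot (nth 0%N P 0) s =
      rot (nth 0%N P 0 + (size s - nth 0%N P i))%N (rot (nth 0%N P i) s).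
    rewrite rotD ?size_rot; last lia.
    by rewrite -[rot (size s - _)%N _]rotD ?subnK ?rot_size // ltnW.
  by move/(segment_gap us ks rq); lia.
move=> i iP; apply/eqP; rewrite eqn_leq low // andbT.
have := @high (size P - i)%N.-1 i ltac:(lia); rewrite prednK ?subn_gt0 // mulnBl.
have : (i * (k - l) <= size P * (k - l))%N by rewrite leq_mul2r (ltnW iP) orbT.
lia.
Qed.

(** Two consecutive edges share an [l]-set, whose colour is the parity of both
    of their intersections with [X]; so all edges have the same parity.  Every
    [k / (k - l)]-th edge gives a perfect matching with [n / k] members, an even
    number, which would make the size of [X] even. *)
Lemma parity_kgraph_no_hamilton_cycle (k l : nat) (T : finType) (X : {set T})
    (f : {ffun {set T} -> bool}) :
  (l < k)%N -> (k - l %| k)%N -> (2 * k %| #|T|)%N -> odd #|X| ->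
  ~ has_hamilton_cycle l (parity_kgraph k l X f).
Proof.
move=> lk dvk dvT oddX [C [[s [P [[us alls] [sP ltP] eC capP szC]]]]] CH.
have T0 : (0 < #|T|)%N.
  by case: (posnP #|X|) oddX => [->//|X0 _]; apply: leq_trans X0 (max_card _).
have ss : size s = #|T|.
  by rewrite -(card_uniqP us); apply: eq_card => x; rewrite alls.
have kT : (k <= #|T|)%N.
  by apply: leq_trans (dvdn_leq T0 dvT); rewrite mul2n -addnn leq_addr.
have ks : (k <= size s)%N by rewrite ss.
have leC : (#|edges C| <= size P)%N.
  have -> : #|edges C| = #|[seq segment k s p | p <- P]| by apply: eq_card.
  by apply: leq_trans (card_size _) _; rewrite size_map.
have szP : (size s <= size P * (k - l))%N by rewrite ss -szC leq_mul2r leC orbT.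
have posP := cycle_positions us ks sP ltP capP szP.
have P0 : (0 < size P)%N.
  by rewrite lt0n; apply: contraTneq szP => ->; rewrite mul0n ss -ltnNge.
have uP : uniq P by apply: sorted_uniq sP; [apply: ltn_trans | apply: ltnn].
have edgeP p : p \in P -> segment k s p \in parity_edges k l X f.
  move=> pP; apply: (subsetP CH); rewrite eC; exact: map_f.
have colour p (L : {set T}) : p \in P -> L \subset segment k s p -> #|L| = l ->
    f L = odd #|segment k s p :&: X|.
  move=> /edgeP; rewrite inE => /andP[_ /forall_inP h] Lp cL.
  by apply/eqP/h; rewrite inE Lp cL eqxx.
have same p : p \in P ->
    odd #|segment k s (next P p) :&: X| = odd #|segment k s p :&: X|.
  move=> pP; have cL := capP _ pP.
  rewrite -(colour _ _ pP (subsetIl _ _) cL).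
  by rewrite -(colour (next P p) _ _ (subsetIr _ _) cL) ?mem_next.
set p0 := nth 0%N P 0; pose b := odd #|segment k s p0 :&: X|.
have const i : (i < size P)%N -> odd #|segment k s (nth 0%N P i) :&: X| = b.
  elim: i => [//|i IHi] iP; rewrite -(IHi (ltnW iP)) -[RHS]same ?mem_nth ?(ltnW iP) //.
  by rewrite next_nth_head ?(ltnW iP) // (set_nth_default 0%N (head 0%N P)).
have [c kc] := dvdnP dvk; have [m Tm] := dvdnP dvT.
pose w := rot p0 s.
have uw : uniq w by rewrite rot_uniq.
have sw : size w = (m.*2 * k)%N by rewrite size_rot ss Tm -muln2 mulnA.
have cX (a : seq T) : uniq a -> count (mem X) a = #|[set x in a] :&: X|.
  move=> ua; rewrite -size_filter -(card_uniqP (filter_uniq _ ua)).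
  by apply: eq_card => x; rewrite !inE mem_filter andbC.
have : odd (count (mem X) w) = odd m.*2 && b.
  apply: (odd_count_blocks sw) => j jm.
  have jP : (j * c < size P)%N.
    have d0 : (0 < k - l)%N by rewrite subn_gt0.
    rewrite -(ltn_pmul2r d0); apply: leq_trans szP.
    by rewrite -mulnA -kc -(size_rot p0) -/w sw ltn_pmul2r //; lia.
  have e1 := posP _ jP; rewrite -mulnA -kc -/p0 in e1.
  rewrite cX ?take_uniq ?drop_uniq // -(const _ jP) e1 addnC.
  congr (odd #|_ :&: _|); apply/setP => x; rewrite !inE rotD -/w; last first.
    by rewrite addnC -e1 ltnW // ltP // mem_nth.
  rewrite /rot takel_cat // size_drop sw -mulnBl leq_pmull // subn_gt0.
  exact: jm.
rewrite cX // odd_double /= => /negbT/negP; apply.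
rewrite (_ : [set x in w] :&: X = X) //; apply/setP => x.
by rewrite !inE mem_rot alls.
Qed.

(** * Choosing the colouring *)

Lemma exists_odd_balanced (R : realType) (T : finType) :
  (1 < #|T|)%N -> ~~ odd #|T| ->
  exists2 X : {set T}, odd #|X| & `| \sum_x (-1) ^+ (x \in X) | <= 2 :> R.
Proof.
(* The odd one of [n / 2] and [n / 2 + 1]. *)
move=> T1 eT; pose c := (#|T|./2 + ~~ odd #|T|./2)%N.
have Tc : #|T| = #|T|./2.*2 by rewrite -{1}(odd_double_half #|T|) (negPf eT).
have cT : (c <= #|T|)%N by rewrite /c; case: odd; lia.
have /card_gt0P[X] : (0 < #|[set X : {set T} | #|X| == c]|)%N.
  by rewrite card_draws bin_gt0.
rewrite inE => /eqP cX; exists X; first by rewrite cX oddD; case: odd.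
have -> : \sum_x (-1) ^+ (x \in X) = #|T|%:R - 2 * c%:R :> R.
  rewrite (bigID (mem X)) /= (eq_bigr (fun=> -1)) => [|x ->]; last by rewrite expr1.
  rewrite [X in _ + X](eq_bigr (fun=> 1)) => [|x /negPf->]; last by rewrite expr0.
  rewrite !sumr_const cX -(cardC (mem X)) natrD -cX.
  by rewrite -[_ *+ #|X|]mulr_natr; ring.
rewrite Tc -muln2 natrM /c natrD ler_norml.
by case: odd => /=; rewrite ?(mulr0n, mulr1n); apply/andP; split; lra.
Qed.

Lemma eventually_ge (R : realType) (x : R) :
  exists n0 : nat, forall n : nat, (n0 <= n)%N -> x <= n%:R.
Proof.
exists (Num.bound `|x|) => n hn; apply: le_trans (ler_norm _) _.
by apply: le_trans (ltW (archi_boundP (normr_ge0 _))) _; rewrite ler_nat.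
Qed.

Lemma expR_sqr_beats_pow (R : realType) (k : nat) (c : R) : 0 < c ->
  exists n0 : nat, forall n : nat, (n0 <= n)%N ->
    2 ^+ (n * k) * expR (- (c * n%:R ^+ 2)) < 2^-1.
Proof.
move=> c0; have [n1 hn1] := eventually_ge ((k%:R + 1) / c).
exists (maxn 2 n1) => n; rewrite geq_max => /andP[n2 /hn1].
rewrite ler_pdivrMr // => hn.
have nR : 2 <= n%:R :> R by rewrite (ler_nat R 2).
have e2 : 2 <= expR 1 :> R by apply: le_trans (expR_ge1Dx _).
have h1 : 2 ^+ (n * k) <= expR (n * k)%:R :> R.
  by rewrite -[X in expR X]mulr1 expRM_natl; apply: lerXn2r; rewrite ?nnegrE ?expR_ge0.
apply: (@le_lt_trans _ _ (expR (- n%:R))).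
  apply: (le_trans (ler_wpM2r (expR_ge0 _) h1)).
  by rewrite -expRD ler_expR natrM; nra.
rewrite expRN ltf_pV2 ?posrE ?expR_gt0 //.
by apply: lt_le_trans (expR_ge1Dx _); lra.
Qed.

Lemma expR_beats_pow (R : realType) (l : nat) (c : R) : 0 < c ->
  exists n0 : nat, forall n : nat, (n0 <= n)%N ->
    n%:R ^+ l * (2 * expR (- (c * n%:R))) < 2^-1.
Proof.
move=> c0; have [n1 hn1] := eventually_ge (4 * (l.+1)`!%:R / c ^+ l.+1).
exists (maxn 1 n1) => n; rewrite geq_max => /andP[n0 /hn1 hn].
have nR0 : 0 < n%:R :> R by rewrite ltr0n.
have cl0 : 0 < c ^+ l.+1 by rewrite exprn_gt0.
have f0 : 0 < (l.+1)`!%:R :> R by rewrite ltr0n fact_gt0.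
rewrite ler_pdivrMr // in hn.
have h := expR_ge1Dxn l (ltW (mulr_gt0 c0 nR0)).
have nl0 : 0 <= n%:R ^+ l :> R by rewrite exprn_ge0.
have h4 : 4 * n%:R ^+ l <= (c * n%:R) ^+ l.+1 / (l.+1)`!%:R.
  rewrite ler_pdivlMr // exprMn [n%:R ^+ l.+1]exprS.
  by have := ler_wpM2r nl0 hn; lra.
rewrite expRN mulrA ltr_pdivrMr ?expR_gt0 //.
lra.
Qed.

(** The first moment method: for [n] large the expected number of failures,
    over all [Y] and all [l]-sets [S] together, is less than 1. *)
Lemma exists_good_colouring (R : realType) (k l : nat) (T : finType) (X : {set T})
    (mu eps : R) :
  (2 <= l)%N -> (l < k)%N -> (0 < #|T|)%N -> 0 < mu -> 0 < eps ->
  `| \sum_x (-1) ^+ (x \in X) | <= 2 :> R ->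
  2 * k%:R ^+ 2 <= mu * #|T|%:R -> 2 * (k + 2)%:R <= eps * #|T|%:R ->
  2 ^+ (#|T| * k) *
    expR (- (mu ^+ 2 / (8 * k%:R ^+ 2 * 'C(k, l)%:R) * #|T|%:R ^+ 2)) < 2^-1 ->
  #|T|%:R ^+ l * (2 * expR (- (eps ^+ 2 / (8 * 'C(k, l)%:R) * #|T|%:R))) < 2^-1 ->
  exists f : {ffun {set T} -> bool},
    dense (2 ^- 'C(k, l)) mu (parity_kgraph k l X f) /\
    forall S : {set T}, #|S| = l ->
      2 ^- 'C(k, l) * 'C(#|T| - l, k - l)%:R - eps * #|T|%:R ^+ (k - l)
        <= (degree (parity_kgraph k l X f) S)%:R.
Proof.
move=> l2 lk T0 mu0 eps0 bal hmu heps.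
set e1 := expR _; set e2 := 2 * _ => he1 he2.
set n := #|T| in he1 he2 *.
pose A (Y : {ffun 'I_k -> {set T}}) : {set {ffun {set T} -> bool}} :=
  [set f | (edge_tuples (parity_kgraph k l X f) Y)%:R <
        2 ^- 'C(k, l) * (\prod_(i < k) #|Y i|%:R) - mu * n%:R ^+ k].
pose B (S : {set T}) : {set {ffun {set T} -> bool}} :=
  [set f | (degree (parity_kgraph k l X f) S)%:R <
        2 ^- 'C(k, l) * 'C(n - l, k - l)%:R - eps * n%:R ^+ (k - l)].
pose Bad := (\bigcup_Y A Y) :|: (\bigcup_(S : {set T} | #|S| == l) B S).
set N := #|{ffun {set T} -> bool}|.
have N0 : 0 < N%:R :> R by rewrite ltr0n /N card_ffun card_bool expn_gt0.
have cA : #|\bigcup_Y A Y|%:R <= N%:R * (2 ^+ (n * k) * e1).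
  apply: (@le_trans _ _ (\sum_Y #|A Y|)%:R).
    by rewrite ler_nat; apply: union_bound => f /bigcupP.
  rewrite natr_sum; apply: (@le_trans _ _ (\sum_(Y : {ffun 'I_k -> {set T}}) N%:R * e1)).
    by apply: ler_sum => Y _; apply: edge_tuples_tail => //; apply: ltnW.
  rewrite sumr_const card_ffun card_ord -cardsT -powersetT card_powerset cardsT -expnM.
  by rewrite -[_ *+ _]mulr_natr natrX -mulrA [e1 * _]mulrC.
have cB : #|\bigcup_(S : {set T} | #|S| == l) B S|%:R <= N%:R * (n%:R ^+ l * e2).
  apply: (@le_trans _ _ (\sum_(S : {set T} | #|S| == l) #|B S|)%:R).
    by rewrite ler_nat; apply: union_bound => f /bigcupP.
  rewrite natr_sum; apply: (@le_trans _ _ (\sum_(S : {set T} | #|S| == l) N%:R * e2)).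
    by apply: ler_sum => S /eqP cS; apply: degree_tail.
  rewrite sumr_const -[_ *+ _]mulr_natr -mulrA ler_wpM2l ?ler0n // mulrC.
  rewrite ler_wpM2r ?mulr_ge0 ?expR_ge0 // -natrX ler_nat.
  apply: leq_trans (bin_le_exp _ _); rewrite -card_draws.
  by apply/subset_leq_card/subsetP => S; rewrite !inE.
have cBad : (#|Bad| < N)%N.
  rewrite -(ltr_nat R).
  apply: (@le_lt_trans _ _ (N%:R * (2 ^+ (n * k) * e1 + n%:R ^+ l * e2))).
    rewrite mulrDr; apply: le_trans (lerD cA cB).
    by rewrite -natrD ler_nat; apply: leq_card_setU.
  by rewrite -[ltRHS]mulr1 ltr_pM2l //; lra.
have /subsetPn[f _] : ~~ ([set: {ffun {set T} -> bool}] \subset Bad).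
  by apply: contraL cBad => /subset_leq_card; rewrite cardsT -leqNgt.
rewrite inE negb_or => /andP[/bigcupP fA /bigcupP fB].
exists f; split=> [Y|S cS]; rewrite leNgt; apply/negP => bad.
  apply: fA; exists (finfun Y) => //; rewrite inE.
  rewrite (eq_bigr (fun i => #|Y i|%:R)) => [|i _]; last by rewrite ffunE.
  rewrite (_ : edge_tuples _ _ = edge_tuples (parity_kgraph k l X f) Y) //.
  apply: eq_card => x; rewrite !inE; congr (_ && _).
  by apply: eq_forallb => i; rewrite ffunE.
by apply: fB; exists S; rewrite ?cS // inE.
Qed.

(** As [n ^ r <= 2 ^ k * k`! * 'C(n, r)], the error term uses up at most half of
    [mu * 'C(n, r)].  The other half pays for replacing ['C(n - j, r)] by
    ['C(n, r)], which costs at most [j * n ^ (r - 1)]. *)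
Lemma degree_bound_numerics (R : realType) (n k j r : nat) (p mu : R) :
  (j <= k)%N -> (0 < r <= k)%N -> (2 * k <= n)%N -> 0 <= p <= 1 -> 0 < mu ->
  2 * (k + 2)%:R <= mu / (2 * (2 ^ k * k`!)%:R) * n%:R ->
  (p - mu) * 'C(n, r)%:R <=
    p * 'C(n - j, r)%:R - mu / (2 * (2 ^ k * k`!)%:R) * n%:R ^+ r.
Proof.
move=> jk /andP[r0 rk] kn /andP[p0 p1] mu0.
set K := (2 ^ k * k`!)%N; set eps := mu / _ => large.
have K0 : 0 < K%:R :> R by rewrite ltr0n muln_gt0 expn_gt0 fact_gt0.
have hC : n%:R ^+ r <= K%:R * 'C(n, r)%:R :> R.
  rewrite -natrX -natrM ler_nat; apply: leq_trans (exp_le_bin _) _; first lia.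
  rewrite leq_mul2r leq_mul ?orbT ?leq_exp2l // leq_pfact // inE; lia.
have muE : mu = 2 * eps * K%:R by rewrite /eps; field; lra.
have eps0 : 0 < eps by rewrite divr_gt0 // mulr_gt0.
have h1 : 2 * eps * n%:R ^+ r <= mu * 'C(n, r)%:R.
  by rewrite muE -[leRHS]mulrA ler_pM2l // mulr_gt0.
have a0 : 0 <= n%:R ^+ r.-1 :> R by rewrite exprn_ge0.
have h2 : p * 'C(n, r)%:R <= p * ('C(n - j, r)%:R + j%:R * n%:R ^+ r.-1).
  rewrite ler_wpM2l // -natrX -natrM -natrD ler_nat.
  rewrite -[in X in (X <= _)%N](prednK r0) -[in X in (_ <= X + _)%N](prednK r0).
  by rewrite bin_subn_ge //; lia.
have h3 : p * (j%:R * n%:R ^+ r.-1) <= 1 * (j%:R * n%:R ^+ r.-1).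
  by rewrite ler_wpM2r // mulr_ge0.
have h4 : j%:R * n%:R ^+ r.-1 <= eps * n%:R ^+ r.
  rewrite -[in X in _ <= X](prednK r0) exprS mulrA ler_wpM2r //.
  by apply: le_trans large; rewrite -natrM ler_nat; lia.
lra.
Qed.

Theorem proposition4 (R : realType) (k l : nat)
    (hk : (3 <= k)%N) (hl2 : (2 <= l)%N) (hlk : (l <= k - 1)%N)
    (hdvd : (k - l %| k)%N) (mu : R) (hmu : 0 < mu) :
  exists n0 : nat, forall n : nat, (n0 <= n)%N -> (2 * k %| n)%N ->
    exists H : kgraph k 'I_n,
      [/\ dense (2%:R ^- 'C(k, l)) mu H,
          forall j : nat, (1 <= j <= l)%N ->
            (2%:R ^- 'C(k, l) - mu) * 'C(n, k - j)%:R <= (min_degree H j)%:R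
        & ~ has_hamilton_cycle l H].
Proof.
have lk : (l < k)%N by lia.
set p : R := 2 ^- 'C(k, l).
have p01 : 0 <= p <= 1.
  by rewrite invr_ge0 exprn_ge0 //= invf_le1 ?exprn_gt0 // exprn_ege1 // ler1n.
have K0 : 0 < (2 ^ k * k`!)%:R :> R by rewrite ltr0n muln_gt0 expn_gt0 fact_gt0.
have C0 : 0 < 'C(k, l)%:R :> R by rewrite ltr0n bin_gt0 ltnW.
have k0 : 0 < k%:R :> R by rewrite ltr0n; lia.
pose eps : R := mu / (2 * (2 ^ k * k`!)%:R).
have eps0 : 0 < eps by rewrite divr_gt0 // mulr_gt0.
have [n1 h1] := eventually_ge (2 * k%:R ^+ 2 / mu).
have [n2 h2] := eventually_ge (2 * (k + 2)%:R / eps).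
have c1 : 0 < mu ^+ 2 / (8 * k%:R ^+ 2 * 'C(k, l)%:R).
  by rewrite divr_gt0 ?exprn_gt0 // !mulr_gt0 ?exprn_gt0.
have [n3 h3] := expR_sqr_beats_pow k c1.
have c2 : 0 < eps ^+ 2 / (8 * 'C(k, l)%:R).
  by rewrite divr_gt0 ?exprn_gt0 // mulr_gt0.
have [n4 h4] := expR_beats_pow l c2.
exists (maxn 1 (maxn n1 (maxn n2 (maxn n3 n4)))) => n.
rewrite !geq_max => /and5P[n0 /h1 {}h1 /h2 {}h2 /h3 {}h3 /h4 {}h4] dvn.
rewrite ler_pdivrMr // [leRHS]mulrC in h1; rewrite ler_pdivrMr // [leRHS]mulrC in h2.
have kn := dvdn_leq n0 dvn.
have n_gt1 : (1 < n)%N by clear -hk kn; lia.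
have even_n : ~~ odd n by case/dvdnP: dvn => q ->; rewrite mulnCA oddM.
have [X oddX balX] : exists2 X : {set 'I_n}, odd #|X| &
    `| \sum_x (-1) ^+ (x \in X) | <= 2 :> R.
  by apply: exists_odd_balanced; rewrite card_ord.
have := @exists_good_colouring R k l 'I_n X mu eps hl2 lk.
rewrite !card_ord => /(_ n0 hmu eps0 balX h1 h2 h3 h4)[f [densef degf]].
exists (parity_kgraph k l X f); split => //; last first.
  by apply: parity_kgraph_no_hamilton_cycle; rewrite ?card_ord.
move=> j /andP[j0 jl].
have [jk jn kn' r0 rk] : [/\ j <= k, j <= n, k <= n, 0 < k - j & k - j <= k]%N.
  by clear -j0 jl lk kn; split; lia.
apply: min_degree_ge => [|S cS]; first by rewrite card_ord.
have := @degree_ge_of_supersets R k l 'I_n (parity_kgraph k l X f) S p eps.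
rewrite card_ord cS => /(_ jl (ltnW lk) kn' (ltW eps0) degf) H.
apply: le_trans H; apply: degree_bound_numerics; rewrite ?r0 //.
Qed.
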